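(* Let $g=(A,v)\in \mathrm{Aff}(n,\mathbb{C})$. The following are equivalent: (i) $g$ is $c$-reversible in $\mathrm{Aff}(n,\mathbb{C})$; (ii) $g$ is strongly $c$-reversible in $\mathrm{Aff}(n,\mathbb{C})$, i.e. $g$ is a product of two coninvolutions in $\mathrm{Aff}(n,\mathbb{C})$; (iii) the linear part $L(g)=A$ is $c$-reversible in $\mathrm{GL}(n,\mathbb{C})$, i.e. there is $B\in\mathrm{GL}(n,\mathbb{C})$ with $BAB^{-1}=\overline{A}^{-1}$.
   Context: $\mathrm{Aff}(n,\mathbb{C})=\mathrm{GL}(n,\mathbb{C})\ltimes\mathbb{C}^n$ is the group of affine maps $z\mapsto Az+v$ of $\mathbb{C}^n$, written $g=(A,v)$ with $A\in\mathrm{GL}(n,\mathbb{C})$, $v\in\mathbb{C}^n$; the product is composition, $(A,v)(B,w)=(AB,Aw+v)$, the identity is $e=(I_n,0)$, and $L(g)=A$ is the linear part. For $g=(A,v)$ set $\overline{g}=(\overline{A},\overline{v})$ (entrywise complex conjugation). An element $h\in\mathrm{Aff}(n,\mathbb{C})$ is a coninvolution if $h\overline{h}=e$. An element $g$ is $c$-reversible if there is $h\in\mathrm{Aff}(n,\mathbb{C})$ with $hgh^{-1}=\overline{g}^{-1}$, and strongly $c$-reversible if such $h$ can be chosen to be a coninvolution. A matrix $A\in\mathrm{GL}(n,\mathbb{C})$ is $c$-reversible in $\mathrm{GL}(n,\mathbb{C})$ if it is conjugate in $\mathrm{GL}(n,\mathbb{C})$ to $\overline{A}^{-1}$. *)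

(* Defs.v *)
From HB Require Import structures.
From mathcomp Require Import all_boot all_order all_algebra.
From mathcomp Require Import complex.
From mathcomp Require Import reals.
Set Implicit Arguments. Unset Strict Implicit. Unset Printing Implicit Defensive.
Import Order.TTheory GRing.Theory Num.Theory.
Local Open Scope ring_scope.

Section Aff.
Variable R : realType.
Local Notation C := (R[i]).

(* An element of Aff(n,C) is a pair (A, v) with A invertible; we represent it by
   the pair and keep invertibility as a separate predicate. *)
Definition aff (n : nat) := ('M[C]_n * 'cV[C]_n)%type.

Definition is_aff n (g : aff n) : Prop := g.1 \in unitmx.

Definition aff_mul n (g h : aff n) : aff n := (g.1 *m h.1, g.1 *m h.2 + g.2).

Definition aff_id n : aff n := (1%:M, 0).

Definition aff_inv n (g : aff n) : aff n := (invmx g.1, - (invmx g.1 *m g.2)).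

Definition aff_conj n (g : aff n) : aff n :=
  (map_mx (@conjc R) g.1, map_mx (@conjc R) g.2).

Definition coninvolution n (h : aff n) : Prop :=
  is_aff h /\ aff_mul h (aff_conj h) = aff_id n.

Definition c_reversible n (g : aff n) : Prop :=
  exists h : aff n, is_aff h /\
    aff_mul (aff_mul h g) (aff_inv h) = aff_inv (aff_conj g).

Definition strongly_c_reversible n (g : aff n) : Prop :=
  exists h : aff n, coninvolution h /\
    aff_mul (aff_mul h g) (aff_inv h) = aff_inv (aff_conj g).

Definition mx_c_reversible n (A : 'M[C]_n) : Prop :=
  exists B : 'M[C]_n, B \in unitmx /\
    B *m A *m invmx B = invmx (map_mx (@conjc R) A).

End Aff.

(* Main.v *)
(* Only (iii) => (ii) is hard.  Choose a real t such that (t-i)A - (t+i) is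
   invertible; the Cayley transform M = (A-1)((t-i)A - (t+i))^-1 turns
   BAB^-1 = conj(A)^-1 into BMB^-1 = conj(M) and has the same image as A-1.

   A matrix M similar to its conjugate satisfies rank p(M) = rank conj(p)(M) for
   every polynomial p.  This condition makes the minimal polynomial of M real, and
   unlike similarity to the conjugate it obviously passes to a complement of the
   companion block of that polynomial, so induction makes M similar to a real
   matrix: PMP^-1 = N is real.

   Modulo the image of N, P v is represented by a vector in the generalized kernel
   of N, and a matrix commuting with N moves this vector to a real one; so one can
   achieve that P(iv) is real modulo the image of N.  Then B = conj(P)^-1 P
   satisfies B conj(B) = 1, reverses A, and Bv + conj(v) lies in the image of
   conj(A)-1, which is the condition for a translation part w such that (B, w)
   reverses (A, v).  Averaging w makes (B, w) a coninvolution. *)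
Require Import Defs.
From HB Require Import structures.
From mathcomp Require Import all_boot all_order all_algebra.
From mathcomp Require Import complex reals.
From mathcomp Require Import ring.
Set Implicit Arguments. Unset Strict Implicit. Unset Printing Implicit Defensive.
Import Order.TTheory GRing.Theory Num.Theory.
Local Open Scope ring_scope.

Local Notation cj := (map_mx Num.conj).
Local Notation cjp := (map_poly Num.conj).

(** * Polynomials evaluated at square matrices of any size *)

Section PolynomialEvaluation.
Variable F : fieldType.

(* Unlike [horner_mx], this also makes sense for matrices of size 0. *)
Definition mxeval n (M : 'M[F]_n) (p : {poly F}) : 'M_n :=
  \sum_(i < size p) p`_i *: M ^+ i.

Lemma mxevalE n (M : 'M[F]_n.+1) p : mxeval M p = horner_mx M p.
Proof.
rewrite -[p in RHS]coefK poly_def rmorph_sum; apply: eq_bigr => i _.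
by rewrite /= horner_mxZ rmorphXn /= horner_mx_X.
Qed.

Lemma expmx_intertwine m n (Q : 'M[F]_(m, n)) M N i :
  Q *m M = N *m Q -> Q *m M ^+ i = N ^+ i *m Q.
Proof.
move=> QM; elim: i => [|i IHi]; first by rewrite !expr0 mulmx1 mul1mx.
by rewrite !exprSr -[M ^+ i * M]/(M ^+ i *m M) mulmxA IHi -mulmxA QM mulmxA.
Qed.

Lemma mxeval_intertwine m n (Q : 'M[F]_(m, n)) M N p :
  Q *m M = N *m Q -> Q *m mxeval M p = mxeval N p *m Q.
Proof.
move=> QM; rewrite /mxeval mulmx_sumr mulmx_suml; apply: eq_bigr => i _.
by rewrite -scalemxAr -scalemxAl (expmx_intertwine _ QM).
Qed.

(** The two coordinate projections intertwine the block matrix with its diagonal blocks, which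
    reduces the claim to [mxeval_intertwine]. *)
Lemma mxeval_block m n (M : 'M[F]_m) (N : 'M[F]_n) p :
  mxeval (block_mx M 0 0 N) p = block_mx (mxeval M p) 0 0 (mxeval N p).
Proof.
have eqM : row_mx 1%:M 0 *m block_mx M 0 0 N = M *m row_mx 1%:M 0.
  by rewrite mul_row_block mul_mx_row !mul1mx !mul0mx mulmx1 mulmx0 !addr0.
have eqN : row_mx 0 1%:M *m block_mx M 0 0 N = N *m row_mx 0 1%:M.
  by rewrite mul_row_block mul_mx_row !mul1mx !mul0mx mulmx1 mulmx0 !add0r.
rewrite -[LHS]mul1mx (scalar_mx_block m n) block_mxEv mul_col_mx.
rewrite (mxeval_intertwine p eqM) (mxeval_intertwine p eqN).
by rewrite !mul_mx_row !mulmx1 !mulmx0.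
Qed.

(** The equality [m = n] is a hypothesis so that sizes such as [d + r] and [n.+1], equal but not
    convertible, can be used. *)
Lemma mxrank_mxeval_similar m n (Q : 'M[F]_(m, n)) M N p :
    m = n -> row_free Q -> Q *m M = N *m Q ->
  \rank (mxeval M p) = \rank (mxeval N p).
Proof.
move=> eq_mn; subst n; move=> Qfree QM; rewrite -(mxrankMfree (mxeval N p) Qfree).
by rewrite -(mxeval_intertwine p QM) eqmxMfull // row_full_unit -row_free_unit.
Qed.

End PolynomialEvaluation.

Lemma map_mxeval (F : fieldType) (f : {rmorphism F -> F}) n (M : 'M[F]_n) p :
  map_mx f (mxeval M p) = mxeval (map_mx f M) (map_poly f p).
Proof.
rewrite /mxeval size_map_poly raddf_sum; apply: eq_bigr => i _.
rewrite /= map_mxZ coef_map /=; congr (_ *: _).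
elim: (i : nat) => [|k IHk]; first by rewrite !expr0 map_mx1.
by rewrite !exprS map_mxM IHk.
Qed.

(** * Vectors of maximal order and the splitting off of a companion block *)

Lemma nat_nonroot (R : numDomainType) (p : {poly R}) :
  p != 0 -> exists k : nat, ~~ root p k%:R.
Proof.
move=> p_neq0; pose s := [seq (k%:R : R) | k <- iota 0 (size p)].
have /allPn[_ /mapP[k _ ->] kP] : ~~ all (root p) s; last by exists k.
apply/negP => all_s; have: (size s < size p)%N.
  by apply: max_poly_roots; rewrite // map_inj_uniq ?iota_uniq // => i j /eqP;
     rewrite eqr_nat => /eqP.
by rewrite size_map size_iota ltnn.
Qed.

(* The moment vector (1, t, t^2, ...) lies in the kernel of a nonzero matrix
   only for finitely many t. *)
Lemma row_avoiding_kernels (R : numFieldType) n (Ks : seq 'M[R]_n) :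
  0 \notin Ks -> exists x : 'rV_n, all (fun K => x *m K != 0) Ks.
Proof.
pose mom (t : R) : 'rV_n := \row_i t ^+ i.
have colp (K : 'M[R]_n) : K != 0 ->
    {p : {poly R} | p != 0 & forall t, mom t *m K = 0 -> root p t}.
  move=> K_neq0; have /sigW[[i j] /= Kij] : exists ij, K ij.1 ij.2 != 0.
    apply/existsP; apply: contraNT K_neq0 => /existsPn K0; apply/eqP/matrixP.
    by move=> i j; have := K0 (i, j); rewrite negbK mxE => /eqP.
  exists (rVpoly (col j K)^T).
    by apply: contraNneq Kij => /(congr1 (coefp i)) /=;
       rewrite coef_rVpoly_ord !mxE coef0 => ->.
  move=> t /rowP/(_ j); rewrite !mxE => tK; apply/rootP; rewrite -{}[RHS]tK.
  rewrite /rVpoly horner_poly; apply: eq_bigr => k _; rewrite insubT // => lt_k.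
  by rewrite !mxE mulrC; congr (_ * K _ _); apply: val_inj.
move=> Ks_neq0; have [p p_neq0 pP] : exists2 p : {poly R}, p != 0 &
    forall t, ~~ root p t -> all (fun K => mom t *m K != 0) Ks.
  elim: Ks Ks_neq0 => [|K Ks IH]; first by exists 1; rewrite ?oner_eq0.
  rewrite in_cons negb_or eq_sym => /andP[/colp[q q_neq0 qP] /IH[p p_neq0 pP]].
  exists (q * p) => [|t]; first by rewrite mulf_neq0.
  rewrite rootM negb_or => /andP[qt /pP pt] /=; rewrite pt andbT.
  by apply: contraNneq qt => /qP.
by have [k /pP kP] := nat_nonroot p_neq0; exists (mom k%:R).
Qed.

(** Take x outside the kernels of (m/(X-z))(M) for all roots z of the minimal polynomial m. If x
    p(M) = 0, then g = gcd(p, m) also kills x by Bezout; were m/g not constant, g would divide some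
    m/(X-z), against the choice of x. *)
Lemma exists_vector_of_maximal_order (C : numClosedFieldType) n (M : 'M[C]_n.+1) :
  exists x : 'rV_n.+1, forall p, x *m horner_mx M p = 0 -> mxminpoly M %| p.
Proof.
set m := mxminpoly M; have m_monic : m \is monic := mxminpoly_monic M.
have m_neq0 := monic_neq0 m_monic.
have [rs def_m] := closed_field_poly_normal m.
have [x /allP xP] : exists x : 'rV_n.+1, all (fun K => x *m K != 0)
    [seq horner_mx M (m %/ ('X - z%:P)) | z <- rs].
  apply: row_avoiding_kernels; apply/mapP => -[z z_rs /esym/mxminpoly_min].
  have zm : 'X - z%:P %| m.
    by rewrite dvdp_XsubCl def_m (monicP m_monic) scale1r root_prod_XsubC.
  have q_neq0 : m %/ ('X - z%:P) != 0 by rewrite dvdp_div_eq0.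
  move=> /(dvdp_leq q_neq0).
  rewrite size_divp ?polyXsubC_eq0 // size_XsubC subn1 -/m.
  by rewrite leqNgt prednK ?leqnn // size_poly_gt0.
exists x => p xp0; set g := gcdp p m.
have xg0 : x *m horner_mx M g = 0.
  have [[u w] /=] := Bezoutp p m; rewrite eqp_sym => /eqpP[[c1 c2] /=].
  case/andP=> c1_neq0 _ def_g; apply: (scalerI c1_neq0).
  rewrite scaler0 scalemxAr -horner_mxZ -/g def_g horner_mxZ rmorphD !rmorphM /=.
  rewrite mx_root_minpoly mulr0 addr0 comm_horner_mx2.
  by rewrite -scalemxAr mulmxA xp0 mul0mx scaler0.
have /dvdpP[h def_h] : g %| m by apply: dvdp_gcdr.
have [/size_poly1P[c c_neq0 def_c]|] := boolP (size h == 1).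
  apply: (dvdp_trans _ (dvdp_gcdl p m)); rewrite -/g def_h def_c mul_polyC.
  by rewrite dvdpZl.
move=> /closed_rootP[z /factor_theorem[h' def_h']].
have z_rs : z \in rs.
  rewrite -root_prod_XsubC -(scale1r (\prod_(_ <- _) _)) -(monicP m_monic).
  by rewrite -def_m def_h def_h' !rootM root_XsubC eqxx orbT.
have /xP/eqP[] : horner_mx M (m %/ ('X - z%:P))
    \in [seq horner_mx M (m %/ ('X - z%:P)) | z <- rs] by apply: map_f.
rewrite def_h def_h' mulrAC mulpK ?polyXsubC_eq0 // rmorphM /=.
by rewrite comm_horner_mx2 mulmxA xg0 mul0mx.
Qed.

Lemma row_free_ker0 (F : fieldType) m n (A : 'M[F]_(m, n)) :
  (forall u : 'rV_m, u *m A = 0 -> u = 0) -> row_free A.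
Proof.
move=> A0; rewrite -kermx_eq0; apply/eqP/row_matrixP => i.
by rewrite row0; apply: A0; rewrite -row_mul mulmx_ker row0.
Qed.

(* X spans the cyclic subspace generated by a vector x of maximal order.  The
   complement is the largest invariant subspace in the kernel of a linear form l
   that is 1 on the last vector of the basis x, xM, ..., and 0 on the others. *)
Lemma split_companion (C : numClosedFieldType) n (M : 'M[C]_n.+1)
    (m := mxminpoly M) (d := (size m).-1) :
  exists r (N : 'M[C]_r) (Q : 'M[C]_(d + r, n.+1)),
    [/\ (d + r = n.+1)%N, row_free Q
      & Q *m M = block_mx (companionmx m) 0 0 N *m Q].
Proof.
have [x xP] := exists_vector_of_maximal_order M; rewrite -/m in xP.
have size_m : size m = d.+1 by rewrite /d /m size_mxminpoly.
have m_monic : m \is monic := mxminpoly_monic M.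
have d_gt0 : (0 < d)%N by rewrite /d /m size_mxminpoly mxminpoly_nonconstant.
have lt_top : (d.-1 < d)%N by rewrite prednK.
have le_top (j : 'I_d) : (j <= d.-1)%N by rewrite -ltnS prednK.
pose top := Ordinal lt_top.
have Md : M ^+ d = - \sum_(i < d) m`_i *: M ^+ i.
  have := mx_root_minpoly M; rewrite -mxevalE -/m /mxeval size_m big_ord_recr.
  have := m_monic; rewrite monicE lead_coefE size_m /= => /eqP ->.
  by rewrite scale1r addrC => /eqP; rewrite addr_eq0 => /eqP.
pose X : 'M_(d, n.+1) := \matrix_(i < d) (x *m M ^+ i).
have rowX (u : 'rV_d) : u *m X = x *m horner_mx M (rVpoly u).
  rewrite horner_rVpoly !(mulmx_sum_row u) linear_sum mulmx_sumr.
  by apply: eq_bigr => i _; rewrite linearZ /= -scalemxAr !rowK mxvecK.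
have X_free : row_free X.
  apply: row_free_ker0 => u; rewrite rowX => /xP /dvdp_leq.
  have [u0 _|_ /(_ isT)] := eqVneq (rVpoly u) 0.
    by rewrite -[u]rVpolyK u0 linear0.
  by rewrite size_m leqNgt ltnS size_poly.
have XM : X *m M = companionmx m *m X.
  apply/row_matrixP => i; rewrite !row_mul rowK -mulmxA.
  rewrite -[M ^+ i *m M]/(M ^+ i * M) -exprSr.
  have [lt_i|ge_i] := ltnP i.+1 d; last first.
    have -> : i = top by apply/val_inj/eqP; rewrite /= eqn_leq le_top -ltnS prednK.
    rewrite /= prednK // Md mulmxN mulmx_sumr mulmx_sum_row -sumrN.
    apply: eq_bigr => j _; rewrite rowK !mxE eqxx scaleNr.
    by rewrite -scalemxAr.
  rewrite (mulmx_sum_row (row _ _)) (bigD1 (Ordinal lt_i)) //= big1 ?addr0.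
    rewrite rowK !mxE eqxx /= -/d ltn_eqF ?scale1r // -ltnS prednK //.
  move=> j neq_j; rewrite !mxE -/d ltn_eqF; last by rewrite -ltnS prednK.
  have /negPf -> : i.+1 != j :> nat.
    by apply: contraNneq neq_j => eq_j; apply/eqP/val_inj.
  by rewrite scale0r.
(* The rows of [X] are independent, so a linear form can be prescribed on them. *)
have [l xMl] : exists l : 'cV_n.+1, forall k, (k < d)%N ->
    x *m M ^+ k *m l = (k == d.-1)%:R%:M.
  exists (pinvmx X *m delta_mx top 0) => k lt_k.
  have -> : x *m M ^+ k = row (Ordinal lt_k) X by rewrite rowK.
  rewrite -row_mul mulmxA mulmxVp // mul1mx.
  by apply/matrixP => a b; rewrite !mxE !ord1 eqxx andbT mulr1n.
(* A row u satisfies u Y = 0 exactly when l vanishes on u M^k for all k < d. *)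
pose Y : 'M_(n.+1, d) := \matrix_(i, j) (M ^+ (d.-1 - j) *m l) i 0.
have colY j : col j Y = M ^+ (d.-1 - j) *m l.
  by apply/colP => i; rewrite !mxE.
have colM p (A : 'M_(p, n.+1)) j : col j (A *m Y) = A *m col j Y.
  by rewrite !colE mulmxA.
(* The entry (i, j) is the value of l at x M^(i + d - 1 - j): it is 1 on the diagonal and 0 above
   it. *)
have XY_unit : X *m Y \in unitmx.
  have XYE i j : (X *m Y) i j = (x *m M ^+ (i + (d.-1 - j)) *m l) 0 0.
    have -> : M ^+ (i + (d.-1 - j)) = M ^+ i *m M ^+ (d.-1 - j) by rewrite exprD.
    rewrite mulmxA -mulmxA -colY -(rowK (fun i => x *m M ^+ i)) -row_mul -colM.
    by rewrite [in RHS]mxE [in RHS]mxE.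
  rewrite unitmxE det_trig ?unitrE.
    rewrite big1 ?divr1 // => i _.
    by rewrite XYE subnKC // xMl // eqxx mxE eqxx.
  apply/is_trig_mxP => i j lt_ij.
  have lt_k : (i + (d.-1 - j) < d.-1)%N.
    by rewrite -[ltnRHS](subnKC (le_top j)) ltn_add2r.
  rewrite XYE xMl; last by apply: ltn_trans lt_k _.
  by rewrite ltn_eqF // !mxE mul0rn.
have [r [U [def_r U_free eqU]]] : exists r (U : 'M_(r, n.+1)),
    [/\ r = \rank (kermx Y), row_free U & (U :=: kermx Y)%MS].
  exists (\rank (kermx Y)), (row_base (kermx Y)).
  by split; rewrite ?row_base_free //; apply: eq_row_base.
have UY : U *m Y = 0 by apply/sub_kermxP; rewrite eqU.
(* The exponent d, reached by [Md], is what makes the row space of [U] invariant under M. *)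
have UMl k : (k <= d)%N -> U *m M ^+ k *m l = 0.
  have small j : (j < d)%N -> U *m M ^+ j *m l = 0.
    move=> lt_j; have lt_k : (d.-1 - j < d)%N.
      by rewrite (leq_ltn_trans (leq_subr _ _)).
    have := colY (Ordinal lt_k); rewrite /= subKn -1?ltnS ?prednK // => def_l.
    by rewrite -mulmxA -def_l -colM UY col0.
  rewrite leq_eqVlt => /predU1P[->|]; last exact: small.
  rewrite Md mulmxN mulNmx mulmx_sumr mulmx_suml big1 ?oppr0 // => i _.
  by rewrite -scalemxAr -scalemxAl small ?scaler0.
have UM : (U *m M <= U)%MS.
  rewrite eqU; apply/sub_kermxP/trmx_inj/row_matrixP => j.
  rewrite -!tr_col; congr _^T.
  rewrite colM colY col0 mulmxA -[_ *m M *m _]mulmxA -[M *m _]/(M * _) -exprS.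
  by rewrite UMl // (leq_ltn_trans (leq_subr _ _)).
exists r, (U *m M *m pinvmx U), (col_mx X U).
have rankY : \rank Y = d.
  apply/eqP; rewrite eqn_leq rank_leq_col /= -{1}(mxrank_unit XY_unit).
  exact: mxrankM_maxr.
split.
- by rewrite def_r mxrank_ker rankY subnKC // -rankY rank_leq_row.
- apply: row_free_ker0 => u; rewrite -[u]hsubmxK mul_row_col => uQ.
  have u10 : lsubmx u = 0.
    have: (lsubmx u *m X + rsubmx u *m U) *m Y = 0 by rewrite uQ mul0mx.
    rewrite mulmxDl -!mulmxA UY mulmx0 addr0 => u1XY.
    by rewrite -(mulmxK XY_unit (lsubmx u)) u1XY mul0mx.
  move: uQ; rewrite u10 mul0mx add0r -[X in _ = X](mul0mx _ U).
  by move/(row_free_inj U_free) ->; rewrite row_mx0.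
by rewrite mul_block_col mul_col_mx XM !mul0mx addr0 add0r mulmxKpV.
Qed.

(** * Similarity to a real matrix from the rank condition *)

Lemma similar_real (C : numClosedFieldType) n (M : 'M[C]_n) :
    (forall p, \rank (mxeval M p) = \rank (mxeval M (cjp p))) ->
  exists2 P : 'M_n, P \in unitmx & exists2 N, cj N = N & P *m M = N *m P.
Proof.
elim/ltn_ind: n => -[|n] IHn in M * => rankM.
  exists 1%:M; first exact: unitmx1.
  by exists M; rewrite ?mul1mx ?mulmx1 // [cj M]flatmx0 [M]flatmx0.
have [r [N [Q [def_n Q_free QM]]]] := split_companion M.
set m := mxminpoly M in Q Q_free QM def_n.
have m_monic : m \is monic := mxminpoly_monic M.
(* By the rank condition the conjugate of m also annihilates M, so m divides it; both are monic of
   the same degree. *)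
have m_real : cjp m = m.
  apply/eqP; rewrite eq_sym -eqp_monic ?map_monic // -dvdp_size_eqp.
    by rewrite size_map_poly.
  apply: mxminpoly_min; apply/eqP; rewrite -mxevalE -mxrank_eq0 -rankM.
  by rewrite mxevalE mx_root_minpoly mxrank0.
have K_real : cj (companionmx m) = companionmx m.
  apply/matrixP => i j; rewrite !mxE; case: ifP => _; last by rewrite rmorph_nat.
  by rewrite rmorphN /= -{1}(coef_map Num.conj) /= m_real.
have lt_rn : (r < n.+1)%N.
  rewrite -def_n -[ltnLHS]add0n ltn_add2r /m size_mxminpoly.
  exact: mxminpoly_nonconstant.
(* Ranks of diagonal blocks add up, and the real companion block contributes the same rank for p and
   its conjugate; cancelling it leaves the rank condition for [N]. *)
have [p|P2 P2_unit [N' N'_real P2N]] := IHn r lt_rn N.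
  have := rankM p; rewrite !(mxrank_mxeval_similar _ def_n Q_free QM).
  rewrite !mxeval_block !rank_diag_block_mx -[X in mxeval X (cjp p)]K_real.
  by rewrite -map_mxeval mxrank_map => /addnI.
pose P : 'M_(_, n.+1) := block_mx 1%:M 0 0 P2 *m Q.
have P_free : row_free P.
  rewrite /row_free mxrankMfree // mxrank_unit //.
  by rewrite unitmxE det_ublock det1 mul1r -unitmxE.
have PM : P *m M = block_mx (companionmx m) 0 0 N' *m P.
  rewrite /P -mulmxA QM !mulmxA !mulmx_block.
  by rewrite !mul1mx !mul0mx !mulmx0 !mulmx1 !addr0 !add0r P2N.
have N_real : cj (block_mx (companionmx m) 0 0 N') = block_mx (companionmx m) 0 0 N'.
  by rewrite map_block_mx K_real N'_real !map_mx0.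
(* Generalizing over both matrices lets the size [d + r] be rewritten to [n.+1]. *)
move: P (block_mx _ _ _ _) P_free PM N_real; rewrite def_n => P K P_free PM KR.
by exists P; [rewrite -row_free_unit | exists K].
Qed.

(** * Columns modulo the image of a matrix *)

Lemma column_in_image_or_separated (F : fieldType) m n (N : 'M[F]_(m, n)) (u : 'cV_m) :
  (exists y, u = N *m y) \/ (exists2 l : 'rV_m, l *m N = 0 & l *m u = 1%:M).
Proof.
have [/submxP[y def_u]|] := boolP (u^T <= N^T)%MS.
  by left; exists y^T; rewrite -[LHS]trmxK def_u trmx_mul trmxK.
rewrite submxE => /eqP coker_u; right.
have [j uj] : exists j, (u^T *m cokermx N^T) 0 j != 0.
  apply/existsP; apply: contraT => /existsPn u0; case: coker_u.
  by apply/rowP => j; rewrite [RHS]mxE; apply/eqP; rewrite -[_ == _]negbK u0.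
pose l := col j (cokermx N^T); set c := _ 0 j in uj.
exists (c^-1 *: l^T).
  rewrite -scalemxAl -[l^T *m N]trmxK trmx_mul trmxK /l colE mulmxA.
  by rewrite mulmx_coker mul0mx trmx0 scaler0.
rewrite -scalemxAl -[l^T *m u]trmxK trmx_mul trmxK /l colE mulmxA -colE.
apply/matrixP => a b; rewrite !ord1 [LHS]mxE 2![X in _ * X]mxE [RHS]mxE.
by rewrite eqxx mulVf.
Qed.

(* P is the transvection-like map y |-> y + sum_j M^j a l(M^(k-j) y), with
   a = w - x; it commutes with M because M^(k+1) kills a and l. *)
Lemma centralizer_moves (F : fieldType) n (M : 'M[F]_n) k (x w : 'cV_n) (l : 'rV_n) :
    M ^+ k.+1 *m x = 0 -> M ^+ k.+1 *m w = 0 -> l *m M ^+ k.+1 = 0 ->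
    l *m M ^+ k *m x = 1%:M -> l *m M ^+ k *m w != 0 ->
  exists2 P : 'M_n, P \in unitmx /\ P *m M = M *m P &
    exists y, P *m x = w + M *m y.
Proof.
move=> Mx Mw lM lx lw; have [a def_a] : exists a, a = w - x by exists (w - x).
have Ma : M ^+ k.+1 *m a = 0 by rewrite def_a mulmxBr Mx Mw subrr.
have la : 1%:M + l *m M ^+ k *m a = l *m M ^+ k *m w.
  by rewrite def_a mulmxBr lx addrC subrK.
have expD i j : M ^+ (i + j) = M ^+ i *m M ^+ j by rewrite exprD.
have expS i : M ^+ i.+1 = M *m M ^+ i by rewrite exprS.
have expSr i : M ^+ i.+1 = M ^+ i *m M by rewrite exprSr.
have lM_ge i : (k < i)%N -> l *m M ^+ i = 0.
  by move=> lt_ki; rewrite -(subnKC lt_ki) expD mulmxA lM mul0mx.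
pose f := \sum_(j < k.+1) M ^+ j *m a *m l *m M ^+ (k - j).
exists (1%:M + f); first split.
- rewrite -row_free_unit; apply: row_free_ker0 => u.
  rewrite mulmxDr mulmx1 mulmx_sumr => u_def.
  (* Multiply [u_def] by M^(k-j) a. Terms with i < k-j contain l M^e with e > k, and those with i >
     k-j vanish by induction. What remains is u M^(k-j) a times 1 + l M^k a = l M^k w, which is
     nonzero. *)
  have c0 j : (j <= k)%N -> u *m M ^+ (k - j) *m a = 0.
    elim/ltn_ind: j => j IHj le_j.
    have := congr1 (fun A => A *m M ^+ (k - j) *m a) u_def.
    rewrite /= !mulmxDl !mul0mx !mulmx_suml.
    have lt_kj : (k - j < k.+1)%N by rewrite ltnS leq_subr.
    rewrite (bigD1 (Ordinal lt_kj)) //= big1 ?addr0 => [|i neq_i].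
      rewrite subKn // -!mulmxA [M ^+ j *m _]mulmxA -expD subnKC // => eq0.
      have : u *m (M ^+ (k - j) *m a) *m (1%:M + l *m (M ^+ k *m a)) = 0.
        by rewrite mulmxDr mulmx1 -!mulmxA.
      rewrite [l *m _]mulmxA la (mx11_scalar (l *m _ *m w)) mul_mx_scalar => /eqP.
      rewrite scaler_eq0 => /orP[/eqP lw0|/eqP //]; case/eqP: lw.
      by rewrite [LHS]mx11_scalar lw0 raddf0.
    have le_ik : (i <= k)%N by rewrite -ltnS.
    have [lt_ij|ge_ij] := ltnP i (k - j).
      rewrite -!mulmxA [l *m _]mulmxA [_ *m (_ *m a)]mulmxA -[_ *m _ *m M ^+ _]mulmxA.
      rewrite -expD lM_ge ?mul0mx ?mulmx0 //.
      by rewrite -{1}(subnK le_ik) ltn_add2l.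
    have lt_kij : (k - i < j)%N.
      rewrite ltn_subLR // addnC -ltn_subLR //.
      rewrite ltn_neqAle ge_ij andbT; apply: contraNneq neq_i => eq_i.
      exact/eqP/val_inj.
    have := IHj _ lt_kij (leq_subr _ _); rewrite subKn // => ua0.
    by rewrite !mulmxA ua0 !mul0mx.
  move: u_def; rewrite big1 ?addr0 // => i _.
  have le_ik : (i <= k)%N by rewrite -ltnS.
  by rewrite !mulmxA -(subKn le_ik) c0 ?leq_subr // !mul0mx.
- rewrite mulmxDl mulmxDr mul1mx mulmx1; congr (_ + _).
  rewrite mulmx_suml mulmx_sumr big_ord_recl big_ord_recr /= subn0 subnn.
  rewrite -[_ *m M ^+ k *m M]mulmxA -expSr -[_ *m l *m _]mulmxA lM mulmx0 add0r.
  rewrite mulmxA mulmxA mulmxA -expS Ma !mul0mx addr0; apply: eq_bigr => i _.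
  rewrite /bump add1n -!mulmxA -expSr -subSn // subSS !mulmxA -expS.
  by [].
(* The term j = 0 equals a because l M^k x = 1; all others lie in the image of M. *)
have fx : f *m x = a + M *m (\sum_(j < k) M ^+ j *m a *m l *m M ^+ (k - j.+1) *m x).
  rewrite /f mulmx_suml big_ord_recl /= subn0 expr0 mul1mx.
  rewrite -!mulmxA [l *m _]mulmxA lx mulmx1; congr (_ + _).
  rewrite mulmx_sumr; apply: eq_bigr => i _.
  by rewrite /bump add1n expS !mulmxA.
exists (\sum_(j < k) M ^+ j *m a *m l *m M ^+ (k - j.+1) *m x).
by rewrite mulmxDl mul1mx fx addrA def_a [x + _]addrC subrK.
Qed.

(** Write the characteristic polynomial as q X^k with q(0) nonzero and put x = q(M) v / q(0).
    Cayley-Hamilton gives M^k x = 0, and v - x lies in the image of M since X divides q - q(0). *)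
Lemma column_nilpotent_mod_image (F : fieldType) n (M : 'M[F]_n) (v : 'cV_n) :
  exists k x y, M ^+ k *m x = 0 /\ v = x + M *m y.
Proof.
case: n => [|n] in M v *; first by exists 0%N, 0, 0; rewrite mulmx0 [v]flatmx0 !flatmx0.
have [k [q]] := multiplicity_XsubC (char_poly M) 0.
rewrite monic_neq0 ?char_poly_monic //= => q0_neq0 def_p.
have /factor_theorem[q1 def_q] : root (q - q.[0]%:P) 0.
  by rewrite /root !hornerE subrr.
have /(congr1 (horner_mx M)) := def_q; rewrite subr0 in def_p def_q *.
rewrite rmorphB rmorphM /= horner_mx_X horner_mx_C => qM.
exists k, (q.[0]^-1 *: (horner_mx M q *m v)).
exists (- (q.[0]^-1 *: (horner_mx M q1 *m v))); split.
  have Mkq : M ^+ k *m horner_mx M q = 0.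
    have := Cayley_Hamilton M.
    by rewrite def_p mulrC rmorphM rmorphXn /= horner_mx_X.
  by rewrite -scalemxAr mulmxA Mkq mul0mx scaler0.
rewrite mulmxN -scalemxAr -scalerBr mulmxA -mulmxBl.
rewrite [M *m _](comm_mx_horner q1 (erefl _)) -[X in _ - X]qM.
by rewrite opprB addrC subrK mul_scalar_mx scalerA mulVf // scale1r.
Qed.

(** Induction on k with M^k x = 0. In the step from k to k+1, if M^k x = M^(k+1) z, then x - M z is
    killed by M^k. Otherwise a form l separates M^k x from the image of M^(k+1), and
    [centralizer_moves] carries x to a real w. *)
Lemma column_real_mod_image (C : numClosedFieldType) n (M : 'M[C]_n) (v : 'cV_n) :
    cj M = M ->
  exists2 P : 'M_n, P \in unitmx /\ P *m M = M *m P &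
    exists y, cj (P *m v - M *m y) = P *m v - M *m y.
Proof.
move=> M_real; have [k [x [y [Mx def_v]]]] := column_nilpotent_mod_image M v.
have Mk_real j : cj (M ^+ j) = M ^+ j.
  elim: j => [|j IHj]; first by rewrite expr0 map_mx1.
  by rewrite exprS map_mxM M_real IHj.
elim: k x y Mx def_v => [|k IHk] x y Mx def_v.
  exists 1%:M; first by rewrite unitmx1 mul1mx mulmx1.
  exists y; rewrite mul1mx def_v addrK.
  by rewrite -[x]mul1mx -[1%:M]/(M ^+ 0) Mx map_mx0.
have [[z Mz]|[l lM lx]] := column_in_image_or_separated (M ^+ k.+1) (M ^+ k *m x).
  apply: (IHk (x - M *m z) (y + z)).
    by rewrite mulmxBr Mz mulmxA -[_ *m M]/(M ^+ k * M) -exprSr subrr.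
  by rewrite mulmxDr [M *m y + _]addrC addrA subrK.
have Mcx : M ^+ k.+1 *m cj x = 0 by rewrite -[M ^+ _]Mk_real -map_mxM Mx map_mx0.
rewrite mulmxA in lx.
(* If l M^k kills x + conj(x), it takes the value 2 at x - conj(x), and i(x - conj(x)) is real. *)
have [w [w_real Mw lw]] : exists w : 'cV_n,
    [/\ cj w = w, M ^+ k.+1 *m w = 0 & l *m M ^+ k *m w != 0].
  have cjK (z : 'cV_n) : cj (cj z) = z by apply/matrixP => a b; rewrite !mxE conjCK.
  have [lw0|] := eqVneq (l *m M ^+ k *m (x + cj x)) 0; last first.
    exists (x + cj x); split=> //; first by rewrite map_mxD cjK addrC.
    by rewrite mulmxDr Mx Mcx addr0.
  exists ('i *: (x - cj x)); split.
  - by rewrite map_mxZ map_mxB cjK /= conjCi scaleNr -scalerN opprB.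
  - by rewrite -scalemxAr mulmxBr Mx Mcx subr0 scaler0.
  rewrite -scalemxAr scaler_eq0 (negPf (neq0Ci C)) /=.
  have <- : l *m M ^+ k *m (x + x) = l *m M ^+ k *m (x - cj x).
    by rewrite -[RHS]addr0 -lw0 -mulmxDr [x + cj x]addrC addrA subrK.
  rewrite mulmxDr lx; apply/eqP => /matrixP/(_ 0 0)/eqP.
  by rewrite !mxE eqxx (pnatr_eq0 _ 2).
have [P P_comm [z Px]] := centralizer_moves Mx Mw lM lx lw.
exists P => //; exists (P *m y + z).
have -> : P *m v - M *m (P *m y + z) = w.
  rewrite def_v !mulmxDr Px mulmxA P_comm.2 -mulmxA opprD addrA.
  by rewrite !addrK.
exact: w_real.
Qed.

(** * The Cayley transform *)

Section Cayley.
Variables (C : numClosedFieldType) (n : nat) (A : 'M[C]_n) (t : nat).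
Let b : C := t%:R - 'i.
Let c : C := t%:R + 'i.

(** As b and c are conjugate, a |-> (a - 1)/(b a - c) maps the unit circle to the real line with
    infinity; t moves the pole c/b along the circle. *)
Definition cayley_den : 'M_n := b *: A - c%:M.
Definition cayley : 'M_n := (A - 1%:M) *m invmx cayley_den.

(** Multiplying B M - conj(M) B by conj(D) on the left and by D on the right gives (c - b)(conj(A) B
    A - B), where c - b = 2i. *)
Lemma cayley_intertwine (B : 'M_n) : cayley_den \in unitmx ->
  B *m cayley = cj cayley *m B <-> cj A *m B *m A = B.
Proof.
move=> D_unit; set D := cayley_den in D_unit *.
have defD : D = b *: A - c%:M by [].
set M := cayley; have defM : M = (A - 1%:M) *m invmx D by [].
clearbody D M; have cD_unit : cj D \in unitmx by rewrite map_unitmx.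
have AD : (A - 1%:M) *m D = D *m (A - 1%:M).
  rewrite mulmxBl mulmxBr mul1mx mulmx1; congr (_ - _).
  by rewrite defD mulmxBl mulmxBr -scalemxAl -scalemxAr scalar_mxC.
have MD : D *m M = A - 1%:M by rewrite defM mulmxA -AD mulmxK.
have DM : M *m D = A - 1%:M by rewrite defM mulmxKV.
have cMD : cj D *m cj M = cj A - 1%:M by rewrite -map_mxM MD map_mxB map_mx1.
have cjD : cj D = c *: cj A - b%:M.
  rewrite defD map_mxB map_mxZ map_scalar_mx; congr (_ *: _ - _%:M).
    by rewrite rmorphB rmorph_nat /= conjCi opprK.
  by rewrite rmorphD rmorph_nat /= conjCi.
have key : cj D *m (B *m M - cj M *m B) *m D =
    (c - b) *: (cj A *m B *m A - B).
  rewrite mulmxBr mulmxBl !mulmxA cMD -!mulmxA DM !mulmxA cjD defD.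
  rewrite !mulmxBl !mulmxBr !mul1mx !mulmx1.
  rewrite -!scalemxAl -!scalemxAr !mul_scalar_mx !mul_mx_scalar -!mulmxA.
  rewrite -?scalemxAl -?scalemxAr.
  set X := cj A *m (B *m A); set Y := cj A *m B; set Z := B *m A.
  apply/matrixP => i j; move: X Y Z => X Y Z; rewrite !mxE.
  by ring.
have cb_neq0 : c - b != 0.
  by rewrite /c /b opprB addrC addrA subrK -mulr2n mulrn_eq0 (negPf (neq0Ci C)).
split=> [BM|BA].
  move: key; rewrite BM subrr mulmx0 mul0mx => /esym/eqP.
  by rewrite scaler_eq0 (negPf cb_neq0) subr_eq0 => /eqP.
move: key; rewrite BA subrr scaler0 => /(congr1 (mulmx^~ (invmx D))).
rewrite mulmxK // mul0mx => /(congr1 (mulmx (invmx (cj D)))).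
by rewrite mulKmx // mulmx0 => /eqP; rewrite subr_eq0 => /eqP.
Qed.

End Cayley.

(** The matrix is t(A - 1) - i(A + 1), whose determinant is a polynomial in t; at t = i it is
    det(-2i), hence nonzero. *)
Lemma cayley_den_unit (C : numClosedFieldType) n (A : 'M[C]_n) :
  exists t, cayley_den A t \in unitmx.
Proof.
pose p := \det ('X *: map_mx polyC (A - 1%:M) - map_mx polyC ('i *: (A + 1%:M))).
have pE z : p.[z] = \det (z *: (A - 1%:M) - 'i *: (A + 1%:M)).
  rewrite -[LHS]/(horner_eval z p) -det_map_mx; congr (\det _).
  by apply/matrixP => i j; rewrite !mxE /= /horner_eval !hornerE.
have p_neq0 : p != 0.
  apply/eqP => p0; have := pE 'i; rewrite p0 horner0 => /esym/eqP.
  rewrite -scalerBr opprD addrACA subrr add0r -opprD -raddfD /= scalerN.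
  rewrite -scaleNr scale_scalar_mx det_scalar expf_eq0 mulf_eq0 oppr_eq0.
  by rewrite (negPf (neq0Ci _)) (pnatr_eq0 _ 2) andbF.
have [t pt] := nat_nonroot p_neq0; exists t.
rewrite unitmxE unitfE; apply: contraNneq pt => det0; apply/rootP.
rewrite pE -[RHS]det0 /cayley_den; congr (\det _).
rewrite !scalerBr scalerDr !scalemx1 opprD addrACA -scalerBl.
by rewrite raddfD /= opprD.
Qed.

(** * Coninvolutive reversers *)

Lemma mxcjK (C : numClosedFieldType) m n (A : 'M[C]_(m, n)) : cj (cj A) = A.
Proof. by apply/matrixP => i j; rewrite !mxE conjCK. Qed.

(* If the affine map (B, w) reverses g, so does the average of w and -B (cj w),
   which makes it a coninvolution. *)
Lemma coninvolutive_translation (C : numClosedFieldType) n (A B : 'M[C]_n) (v w : 'cV_n) :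
    B *m cj B = 1%:M -> cj A *m B *m A = B ->
    (1%:M - cj A) *m w = cj A *m B *m v + cj v ->
  exists2 w', B *m cj w' + w' = 0 & (1%:M - cj A) *m w' = cj A *m B *m v + cj v.
Proof.
move=> BB ABA Aw; exists (2^-1 *: (w - B *m cj w)).
  rewrite map_mxZ map_mxB map_mxM mxcjK fmorphV rmorph_nat -scalemxAr -scalerDr.
  by rewrite mulmxBr mulmxA BB mul1mx addrA subrK subrr scaler0.
have AwB : (1%:M - cj A) *m (- (B *m cj w)) = cj A *m B *m v + cj v.
  have := congr1 (fun u => cj A *m B *m cj u) Aw.
  rewrite /= map_mxM map_mxB map_mx1 mxcjK map_mxD !map_mxM !mxcjK => cAw.
  have -> : cj A *m B *m v + cj v = cj A *m B *m ((1%:M - A) *m cj w).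
    by rewrite cAw mulmxDr !mulmxA ABA BB mul1mx [RHS]addrC.
  rewrite mulmxN !mulmxBl mulmxBr !mul1mx !mulmxA ABA.
  by rewrite opprB.
rewrite -scalemxAr mulmxDr Aw AwB -mulr2n -scaler_nat scalerA mulVf ?scale1r //.
by rewrite pnatr_eq0.
Qed.

Lemma exists_coninvolutive_reverser (C : numClosedFieldType) n (A B : 'M[C]_n) (v : 'cV_n) :
    B \in unitmx -> cj A *m B *m A = B ->
  exists B' w, [/\ B' *m cj B' = 1%:M, cj A *m B' *m A = B',
    B' *m cj w + w = 0 & (1%:M - cj A) *m w = cj A *m B' *m v + cj v].
Proof.
move=> B_unit ABA; have [t D_unit] := cayley_den_unit A.
have [_ /(_ ABA) BM] := cayley_intertwine B D_unit.
set M := cayley A t in BM.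
have [p|Q Q_unit [N N_real QM]] := similar_real (M := M).
  rewrite [RHS](mxrank_mxeval_similar (Q := B) (N := cj M)) ?row_free_unit //.
  by rewrite -map_mxeval mxrank_map.
have [P0 [P0_unit P0N] [y y_real]] := column_real_mod_image (Q *m ('i *: v)) N_real.
pose P := P0 *m Q.
have P_unit : P \in unitmx by rewrite unitmx_mul P0_unit.
have cP_unit : cj P \in unitmx by rewrite map_unitmx.
have PM : P *m M = N *m P by rewrite /P -mulmxA QM !mulmxA P0N.
have Pv : P0 *m (Q *m ('i *: v)) = 'i *: (P *m v).
  by rewrite -!scalemxAr mulmxA.
rewrite {}Pv in y_real; clearbody P.
have cPM : cj P *m cj M = N *m cj P by rewrite -map_mxM PM map_mxM N_real.
have McP : cj M *m invmx (cj P) = invmx (cj P) *m N.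
  by rewrite -[LHS](mulKmx cP_unit) [cj P *m _]mulmxA cPM mulmxK.
pose B' := invmx (cj P) *m P.
have B'B' : B' *m cj B' = 1%:M.
  by rewrite /B' map_mxM map_invmx mxcjK -mulmxA mulKVmx // mulVmx.
have B'M : B' *m M = cj M *m B' by rewrite /B' -mulmxA PM !mulmxA McP.
have AB'A : cj A *m B' *m A = B' by apply/(cayley_intertwine B' D_unit).
(* Since i P v is real modulo the image of N, P v is purely imaginary modulo that image. *)
have [z def_z] : exists z, P *m v + cj (P *m v) = N *m z.
  exists (- ('i *: (y - cj y))); move: (P *m v) y_real => s.
  rewrite map_mxB map_mxZ map_mxM N_real /= conjCi.
  move=> /(congr1 (fun u => 'i *: (u + N *m cj y))).
  rewrite subrK scalerA mulrN -expr2 sqrCi opprK scale1r => ->.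
  rewrite -[_ - _ + _]addrA scalerDr scalerA -expr2 sqrCi scaleN1r addrA subrr.
  by rewrite add0r -scalerN -scalemxAr opprB mulmxBr addrC.
have cM : cj M = (cj A - 1%:M) *m invmx (cj (cayley_den A t)).
  by rewrite map_mxM map_mxB map_mx1 map_invmx.
(* The first summand is -u, where u solves (conj(A) - 1) u = B' v + conj(v); subtracting B' v turns
   this into the required equation. *)
pose w := - (invmx (cj (cayley_den A t)) *m (invmx (cj P) *m z)) - B' *m v.
have [|w' w'1 w'2] := coninvolutive_translation (w := w) (v := v) B'B' AB'A.
  have z_eq : (cj A - 1%:M) *m (invmx (cj (cayley_den A t)) *m (invmx (cj P) *m z))
      = B' *m v + cj v.
    rewrite [LHS]mulmxA -cM mulmxA McP -mulmxA -def_z mulmxDr map_mxM mulKmx //.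
    by rewrite mulmxA.
  rewrite /w mulmxBr mulmxN -mulNmx opprB z_eq mulmxBl mul1mx mulmxA.
  by rewrite opprB addrC addrA subrK.
by exists B', w'.
Qed.

(** * Reversers of an affine map and of its linear part *)

Theorem theorem1 (R : realType) (n : nat) (A : 'M[R[i]]_n) (v : 'cV[R[i]]_n) :
  A \in unitmx ->
  [<-> c_reversible (A, v); strongly_c_reversible (A, v); mx_c_reversible A].
Proof.
move=> A_unit.
have cA_unit : cj A \in unitmx by rewrite map_unitmx.
have reversible : mx_c_reversible A -> strongly_c_reversible (A, v).
  case=> B [B_unit BAB].
  have ABA : cj A *m B *m A = B.
    rewrite -mulmxA -[B *m A](mulmxKV B_unit) BAB mulmxA.
    by rewrite [_ *m invmx _](mulmxV cA_unit) mul1mx.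
  have [B' [w [B'B' AB'A B'w Aw]]] := exists_coninvolutive_reverser v B_unit ABA.
  have [B'_unit _] := mulmx1_unit B'B'.
  exists (B', w); split; first by split=> //; congr pair.
  have AB' : B' *m A = invmx (cj A) *m B' by rewrite -[in RHS]AB'A -mulmxA mulKmx.
  have -> : aff_inv (aff_conj (A, v)) =
      (invmx (cj A), - (invmx (cj A) *m cj v)) by [].
  rewrite /aff_mul /aff_inv /=; congr pair; first by rewrite AB' mulmxK.
  (* Multiplied by conj(A), the equality of translation parts becomes [Aw]. *)
  apply: (can_inj (mulKmx cA_unit)).
  rewrite AB' mulmxDr !mulmxN !mulmxA !mulmxV // !mul1mx mulmxV // mul1mx.
  rewrite -[cj v](addKr (cj A *m B' *m v)) -Aw mulmxBl mul1mx mulmxDr mulmxA.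
  by rewrite opprD opprK opprB [LHS]addrC addrA.
tfae.
- case=> h [h_aff eq_h]; apply: reversible; exists h.1; split; first exact: h_aff.
  exact: (congr1 (fun g : aff R n => g.1) eq_h).
- case=> h [[h_aff _] eq_h]; exists h.1; split; first exact: h_aff.
  exact: (congr1 (fun g : aff R n => g.1) eq_h).
- by case/reversible=> h [[h_aff _] eq_h]; exists h.
Qed.
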